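(* Let $N\geq 3$ be an integer, let $p=p_S(N)=\frac{N+2}{N-2}$, and let $\psi:\mathbb{R}^N\setminus\{0\}\to(0,\infty)$ be an arbitrary Delaunay-type singular solution. Then the following hold. (a) If $u=u(x,t)$ is a real-valued classical solution of $$u_t=\Delta u+|u|^{p-1}u,\qquad x\in\mathbb{R}^N,\ t\leq 0,$$ such that $|u(x,t)|\leq\psi(x)$ for all $x\in\mathbb{R}^N\setminus\{0\}$ and $t\leq 0$, then $u\equiv 0$ on $\mathbb{R}^N\times(-\infty,0]$. (b) Let $M\geq 0$ be an integer. If $u$ is a real-valued classical ($C^2$) solution of $$\Delta u+|u|^{p-1}u=0,\qquad (x,y)\in\mathbb{R}^{N+M},\quad x\in\mathbb{R}^N,\ y\in\mathbb{R}^M,$$ such that $|u(x,y)|\leq\psi(x)$ for all $x\in\mathbb{R}^N\setminus\{0\}$ and $y\in\mathbb{R}^M$, then $u\equiv 0$ on $\mathbb{R}^{N+M}$.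
   Context: For $N\ge3$, a Delaunay-type singular solution is a function on $\mathbb{R}^N\setminus\{0\}$ of the form $$\psi(x)=|x|^{-\frac{N-2}{2}}\,v\left(\ln|x|\right),$$ where $v:\mathbb{R}\to(0,\infty)$ is a positive periodic solution of the ordinary differential equation $$-v''+\frac{(N-2)^2}{4}v-v^{\frac{N+2}{N-2}}=0\quad\text{in }\mathbb{R}$$ (the constant solution $v\equiv\left(\frac{N-2}{2}\right)^{\frac{N-2}{2}}$ is allowed). In (a), $\Delta$ is the Laplacian in $x\in\mathbb{R}^N$, and a classical solution on $\mathbb{R}^N\times(-\infty,0]$ is a function $u$ such that $u$, $u_t$ and the first and second order partial derivatives of $u$ in $x$ exist and are continuous on $\mathbb{R}^N\times(-\infty,0]$ (with $u_t$ one-sided at $t=0$), and which satisfies the equation pointwise. In (b), $\Delta$ is the Laplacian in all $N+M$ variables; when $M=0$ the variable $y$ is absent and $u=u(x)$ is a function on $\mathbb{R}^N$. *)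

(* Defs.v *)
From HB Require Import structures.
From mathcomp Require Import all_boot all_order all_algebra.
From mathcomp Require Import all_classical all_reals all_analysis.
Set Implicit Arguments.
Unset Strict Implicit.
Unset Printing Implicit Defensive.
Import Order.TTheory GRing.Theory Num.Theory.
Import numFieldNormedType.Exports.
Local Open Scope classical_set_scope.
Local Open Scope ring_scope.

Section Defs.
Variable R : realType.

(* The library norm on row vectors is the sup norm, hence this definition. *)
Definition enorm (n : nat) (x : 'rV[R]_n) : R :=
  Num.sqrt (\sum_(i < n) x ord0 i ^+ 2).

Definition basis_vec (n : nat) (i : 'I_n) : 'rV[R]_n := delta_mx ord0 i.

Definition partial (n : nat) (i : 'I_n) (f : 'rV[R]_n -> R) : 'rV[R]_n -> R :=
  fun x => 'D_(basis_vec i) f x.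

Definition has_partial (n : nat) (i : 'I_n) (f : 'rV[R]_n -> R)
    (x : 'rV[R]_n) : Prop :=
  derivable f x (basis_vec i).

Definition laplacian (n : nat) (f : 'rV[R]_n -> R) (x : 'rV[R]_n) : R :=
  \sum_(i < n) partial i (partial i f) x.

Definition C2 (n : nat) (f : 'rV[R]_n -> R) : Prop :=
  [/\ continuous f,
      forall i x, has_partial i f x,
      forall i, continuous (partial i f),
      forall i j x, has_partial j (partial i f) x &
      forall i j, continuous (partial j (partial i f))].

Definition pS (N : nat) : R := (N%:R + 2) / (N%:R - 2).

Definition power_nonlin (p a : R) : R := `|a| `^ (p - 1) * a.

Definition delaunay_profile (N : nat) (v : R -> R) : Prop :=
  [/\ forall s, 0 < v s,
      exists2 T : R, 0 < T & forall s, v (s + T) = v s,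
      forall s, derivable v s 1,
      forall s, derivable (derive1 v) s 1 &
      forall s, - derive1n 2 v s + (N%:R - 2) ^+ 2 / 4 * v s - v s `^ pS N = 0].

(* The value of psi at the origin is unconstrained. *)
Definition delaunay_solution (N : nat) (psi : 'rV[R]_N -> R) : Prop :=
  exists2 v : R -> R, delaunay_profile N v &
    forall x, x != 0 ->
      psi x = enorm x `^ (- ((N%:R - 2) / 2)) * v (ln (enorm x)).

(* Functions on R^n x (-oo, 0] are represented by total functions whose values
   at positive times are never used: in the difference quotient in time the
   increment is restricted to s <= 0, so that it is one-sided at t = 0. *)
Definition time_quotient (n : nat) (u : 'rV[R]_n -> R -> R) (x : 'rV[R]_n)
    (t s : R) : R := (u x s - u x t) / (s - t).

Definition has_time_deriv (n : nat) (u : 'rV[R]_n -> R -> R) (x : 'rV[R]_n)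
    (t : R) : Prop :=
  cvg (time_quotient u x t s @[s --> within [set s | s <= 0] t^']).

Definition time_deriv (n : nat) (u : 'rV[R]_n -> R -> R) (x : 'rV[R]_n)
    (t : R) : R :=
  lim (time_quotient u x t s @[s --> within [set s | s <= 0] t^']).

Definition continuous_past (n : nat) (u : 'rV[R]_n -> R -> R) : Prop :=
  {within [set z : 'rV[R]_n * R | z.2 <= 0], continuous (fun z => u z.1 z.2)}.

Definition space_partial (n : nat) (i : 'I_n) (u : 'rV[R]_n -> R -> R) :
    'rV[R]_n -> R -> R := fun x t => partial i (u^~ t) x.

Definition classical_past (n : nat) (u : 'rV[R]_n -> R -> R) : Prop :=
  [/\ continuous_past u,
      forall x t, t <= 0 -> has_time_deriv u x t,
      continuous_past (time_deriv u),
      forall i, (forall x t, t <= 0 -> has_partial i (u^~ t) x) /\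
                continuous_past (space_partial i u) &
      forall i j,
        (forall x t, t <= 0 -> has_partial j (space_partial i u ^~ t) x) /\
        continuous_past (space_partial j (space_partial i u))].

Definition heat_solution (n : nat) (p : R) (u : 'rV[R]_n -> R -> R) : Prop :=
  classical_past u /\
  forall x t, t <= 0 ->
    time_deriv u x t = laplacian (u^~ t) x + power_nonlin p (u x t).

Definition elliptic_solution (n : nat) (p : R) (u : 'rV[R]_n -> R) : Prop :=
  C2 u /\ forall z, laplacian u z + power_nonlin p (u z) = 0.

End Defs.

(* Main.v *)
Require Import Defs.
From mathcomp Require Import all_boot all_order all_algebra.
From mathcomp Require Import all_classical all_reals all_analysis.
From mathcomp Require Import ring lra.
Import Order.TTheory GRing.Theory Num.Theory.
Import numFieldNormedType.Exports.
Local Open Scope classical_set_scope.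
Local Open Scope ring_scope.

Set Implicit Arguments.
Unset Strict Implicit.

(** Both parts are instances of one statement on ancient solutions: in R^n the
  coordinates are split into a set P of N coordinates, which form x, and the
  others, which form y; the solution satisfies |u| <= psi(x) for t <= 0. Part
  (a) has no y, and part (b) is the case of a solution constant in time. By
  oddness of the equation it is enough to prove u <= 0.

  Put s = ln |x|, gamma = (N-2)/2 and psi = exp(-gamma s) v(s). The ratio
  z = u/psi solves a diffusion equation with the absorption term
  - v^(p-1) z (1 - |z|^(p-1)): the state z = 0 is stable and the state z = 1,
  that is u = psi, is unstable. Since u is bounded near x = 0, locally in time,
  and psi is not, z tends to 0 at the singularity. Hence the stable state invades the unstable
  one from the origin outwards, as in the Fisher-KPP equation, and an ancient
  solution has given it an infinite time to do so.

  The proof makes this quantitative with one explicit barrier. Let r be a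
  primitive of v^(-2); in the variable r the ratio equation has no first order
  term. For a small alpha, with E = exp(alpha r(s)), the barrier is psi b with
    b = (3/2) E / (E + g),   g = a (L^2 - |y - y0|^2 + (t - t0)),
  a logistic front in r whose position depends on y and t through g. The
  saturation level of the logistic function is 3/2 and not 1, so b crosses the
  level 1 with a positive slope; there the diffusion term is already negative,
  which compensates the degeneracy of the absorption at z = 1
  ([logistic_supersolution]). As long as aL is small the front moves so slowly
  that its contribution is negligible ([slow_front]), and psi b cannot touch u
  from above ([no_contact]).

  The set where g > 0 is a paraboloid of size L, and the quantity
  z / (3/2 - z) * g / E is at most 1 near x = 0, for large |x|, and on the
  boundary of the paraboloid. If it exceeded 1 somewhere, its maximum over a
  compact set would be a contact point with the barrier for a smaller a, which
  is impossible. At (y0, t0) this gives z / (3/2 - z) <= E / (a L^2), and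
  a L^2 can be taken arbitrarily large: see [upper_estimate] and
  [nonpositive_off_axis]. *)

(** * Calculus in one variable *)

Section OneVariable.
Variable R : realType.
Implicit Types (f g : R -> R) (a l : R).

Lemma is_derive_continuous f a l : is_derive a 1 f l -> {for a, continuous f}.
Proof. by move=> h; apply/differentiable_continuous/derivable1_diffP; case: h. Qed.

Lemma is_derive_chain f g a df dg :
  is_derive (g a) 1 f df -> is_derive a 1 g dg ->
  is_derive a 1 (f \o g) (df * dg).
Proof.
move=> [hf ef] [hg eg]; apply: DeriveDef.
  by apply/derivable1_diffP; apply: differentiable_comp; exact/derivable1_diffP.
by rewrite -derive1E derive1_comp// !derive1E ef eg.
Qed.

Lemma is_derive_inv f a df :
  f a != 0 -> is_derive a 1 f df ->
  is_derive a 1 (fun y => (f y)^-1) (- df / f a ^+ 2).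
Proof.
move=> f0 [hf ef]; apply: DeriveDef; first exact: derivableV.
by rewrite deriveV// ef /GRing.scale /= mulrC mulrN mulNr.
Qed.

(** If f1 had a negative slope at its zero a, then f would decrease strictly to
  the right of a. The derivatives are taken pointwise, as they are given along
  a coordinate line. *)
Lemma second_derivative_min f f1 a l :
  (\forall y \near a, is_derive (y : R) (1 : R) f (f1 y)) ->
  is_derive a 1 f1 l -> (\forall y \near a, f a <= f y) -> 0 <= l.
Proof.
move=> df df1 fmin; rewrite leNgt; apply/negP => l0.
have f1a : f1 a = 0.
  have : \forall y \near a, is_derive (y : R) (1 : R) f (f1 y) /\ f a <= f y by near=> y; split; near: y.
  move=> /nbhs_ballP[e /= e0 he].
  have h t : t \in `]a - e, a + e[%R -> is_derive t 1 f (f1 t) /\ f a <= f t.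
    rewrite in_itv /= => /andP[t1 t2]; apply: he.
    by rewrite /ball /= ltr_distlC t1 t2.
  have ae : a \in `]a - e, a + e[%R by rewrite in_itv /=; apply/andP; split; lra.
  have /= [] := @derive1_at_min R f (a - e) (a + e) a.
  - lra.
  - by move=> t /h[[]].
  - by [].
  - by move=> t /h[].
  by move=> _ <-; have [[_ ->] _] := h _ ae.
(* the slope of f1 at a is negative, so f1 < 0 just to the right of a *)
have : \forall y \near a^'+, f1 y < 0.
  have hh : (fun h => h^-1 *: ((f1 \o shift a) (h *: 1) - f1 a)) @ 0^' --> l.
    by case: df1 => c <-; exact: c.
  have : nbhs (0 : R) [set h : R | h != 0 -> h^-1 *: ((f1 \o shift a) (h *: 1) - f1 a) < 0].
    exact: (cvgr_lt l hh 0 l0).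
  move=> /nbhs_ballP[e /= e0 he].
  exists e => //= y hb ay.
  have hba : ball (0 : R) e (y - a) by move: hb; rewrite /ball /= sub0r normrN distrC.
  have := he _ hba; rewrite /= gt_eqF ?subr_gt0// => /(_ isT).
  rewrite /GRing.scale /= mulr1 subrK f1a subr0.
  by rewrite pmulr_rlt0// invr_gt0 subr_gt0.
move=> /nbhs_ballP[e0 /= e00 he0].
have : \forall y \near a, is_derive (y : R) (1 : R) f (f1 y) /\ f a <= f y by near=> y; split; near: y.
move=> /nbhs_ballP[e1 /= e10 he1].
pose e := Num.min e0 e1 / 2.
have [e_gt0 ee0 ee1] : [/\ 0 < e, e < e0 & e < e1].
  rewrite /e; have : 0 < Num.min e0 e1 by rewrite lt_min e00 e10.
  have h1 : Num.min e0 e1 <= e0 by rewrite ge_min lexx.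
  have h2 : Num.min e0 e1 <= e1 by rewrite ge_min lexx orbT.
  by move=> h; split; lra.
have h1 y : a <= y <= a + e -> is_derive (y : R) (1 : R) f (f1 y) /\ f a <= f y.
  move=> /andP[y1 y2]; apply: he1; rewrite /ball /= ler0_norm; lra.
have h0 y : a < y <= a + e -> f1 y < 0.
  move=> /andP[y1 y2]; apply: he0 => //; rewrite /ball /= ler0_norm; lra.
have [|||c] := @MVT R f f1 a (a + e).
- lra.
- by move=> x; rewrite in_itv /= => /andP[x1 x2]; apply: (h1 x _).1; rewrite !ltW.
- apply: derivable_within_continuous => x; rewrite in_itv /= => xh.
  by case: (h1 x xh) => -[].
rewrite in_itv /= => /andP[c1 c2] h.
have := h0 c; rewrite c1 (ltW c2) => /(_ isT) fc.
have [|_] := h1 (a + e); first by apply/andP; split; lra.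
rewrite -subr_ge0 h; have -> : a + e - a = e by ring.
by rewrite pmulr_lge0// leNgt fc.
Unshelve. all: by end_near. Qed.

Local Notation mu := (@lebesgue_measure R).

(** The integral from -A to s minus the integral from -A to 0 does not depend
  on A, as soon as A > |s|; a value of A that is good near s gives the
  derivative at s. *)
Lemma primitive_exists f : continuous f ->
  exists2 F : R -> R, F 0 = 0 & forall s : R, is_derive s (1 : R) F (f s).
Proof.
move=> cf.
have intf a b : mu.-integrable `[a, b] (EFin \o f).
  apply: continuous_compact_integrable; first exact: segment_compact.
  exact/continuous_subspaceT.
pose G A s : R := \int[mu]_(t in `[- A, s]) f t.
have GG A B s : B <= A -> - B <= s -> G A s = G A (- B) + \int[mu]_(t in `]- B, s]) f t.
  move=> BA Bs; have BA' : - A <= - B by rewrite lerN2.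
  have := @Rintegral_itvB R f (BLeft (- A)) (BRight s) (- B) (intf _ _) BA' Bs.
  by move=> <-; rewrite addrC subrK.
pose F s := G (`|s| + 1) s - G (`|s| + 1) 0.
have FE A s : `|s| + 1 <= A -> F s = G A s - G A 0.
  move=> sA; have n0 := normr_ge0 s; have ns := ler_norm (- s); rewrite normrN in ns.
  rewrite /F (GG A (`|s| + 1) s)//; last by lra.
  rewrite (GG A (`|s| + 1) 0)//.
  rewrite (GG (`|s| + 1) (`|s| + 1) s)//; last by lra.
  rewrite (GG (`|s| + 1) (`|s| + 1) 0)//.
  by ring.
exists F; first by rewrite /F subrr.
move=> s; pose A := `|s| + 2.
have /= [dG GE] : derivable (G A) s 1 /\ derive1 (G A) s = f s.
  apply: (@continuous_FTC1_closed R f (- A) s (s + 1)) => //.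
  - lra.
  - by have := ler_norm (- s); rewrite normrN /A => ?; lra.
  - exact: cf.
apply: (@near_eq_is_derive _ _ _ (fun s => G A s - G A 0)).
  exists 1 => //= y; rewrite /ball /= => ys; apply/esym/FE.
  have := ler_normD (y - s) s; rewrite subrK distrC /A => ?; lra.
have hG : is_derive s 1 (G A) (f s) by apply: DeriveDef => //; rewrite -derive1E.
by apply: is_derive_eq; rewrite subr0.
Qed.

Lemma periodic_int f T : (forall s, f (s + T) = f s) ->
  forall (k : int) s, f (s + k%:~R * T) = f s.
Proof.
move=> fT.
have h (n : nat) s : f (s + n%:R * T) = f s.
  elim: n s => [s|n IH s]; first by rewrite mul0r addr0.
  by rewrite -addn1 natrD mulrDl mul1r addrA fT IH.
case=> n s; first exact: h.
by rewrite NegzE -[in RHS](subrK ((n.+1)%:R * T) s) h mulrNz mulNr.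
Qed.

Lemma periodic_positive_bounds f T : 0 < T -> continuous f ->
  (forall s, f (s + T) = f s) -> (forall s, 0 < f s) ->
  exists m M : R, 0 < m /\ forall s, m <= f s <= M.
Proof.
move=> T0 cf fT f0.
have cf' : {within `[0, T], continuous f} by exact/continuous_subspaceT.
have [c _ cmax] := EVT_max (ltW T0) cf'.
have [d _ dmin] := EVT_min (ltW T0) cf'.
exists (f d), (f c); split => // s.
have -> : f s = f (s - (Num.floor (s / T))%:~R * T).
  by rewrite -[LHS](periodic_int fT (- Num.floor (s / T))) mulrNz mulNr.
have : s - (Num.floor (s / T))%:~R * T \in `[0, T]%R.
  have := floor_le (s / T); have := floorD1_gt (s / T).
  rewrite ler_pdivlMr// ltr_pdivrMr// intrD mulrDl mul1r => h1 h2.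
  by rewrite in_itv /=; apply/andP; split; lra.
by move=> h; rewrite cmax// dmin.
Qed.

End OneVariable.

(** * Touching from above by functions of square distances *)

Section Touching.
Variables (R : realType) (n : nat).
Implicit Types (P : pred 'I_n) (c z : 'rV[R]_n) (i : 'I_n) (f u : 'rV[R]_n -> R).

Definition sqdist P c z : R := \sum_(i | P i) (z ord0 i - c ord0 i) ^+ 2.

Lemma sqdist_ge0 P c z : 0 <= sqdist P c z.
Proof. by apply: sumr_ge0 => i _; exact: sqr_ge0. Qed.

Lemma line_coord z i h j :
  (z + h *: basis_vec R i) ord0 j = z ord0 j + h * (j == i)%:R.
Proof. by rewrite !mxE eqxx. Qed.

Lemma sqdist_line P c z i h : P i ->
  sqdist P c (z + h *: basis_vec R i) =
  sqdist P c z + 2 * (z ord0 i - c ord0 i) * h + h ^+ 2.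
Proof.
move=> Pi; rewrite /sqdist (bigD1 i)//= [in RHS](bigD1 i)//= line_coord eqxx mulr1.
rewrite (eq_bigr (fun j => (z ord0 j - c ord0 j) ^+ 2)); last first.
  by move=> j /andP[_ ji]; rewrite line_coord (negbTE ji) mulr0 addr0.
by ring.
Qed.

Lemma sqdist_line_out P c z i h : ~~ P i ->
  sqdist P c (z + h *: basis_vec R i) = sqdist P c z.
Proof.
move=> Pi; apply: eq_bigr => j Pj; rewrite line_coord.
by case: eqVneq Pj => [->|_ _]; [rewrite (negbTE Pi)|rewrite mulr0 addr0].
Qed.

Lemma is_derive_line f z i k : has_partial i f (z + k *: basis_vec R i) ->
  is_derive k 1 (fun h : R => f (z + h *: basis_vec R i))
    (partial i f (z + k *: basis_vec R i)).
Proof.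
set e := basis_vec R i => df.
have E : (fun h : R => h^-1 *: (((fun h : R => f (z + h *: e)) \o shift k) (h *: 1) -
     f (z + k *: e))) =
  (fun h : R => h^-1 *: ((f \o shift (z + k *: e)) (h *: e) - f (z + k *: e))).
  apply/funext => h /=; congr (_ *: (f _ - _)).
  by rewrite /GRing.scale/= mulr1 -!/(GRing.scale _ _) scalerDl addrCA.
by apply: DeriveDef; rewrite /derivable /derive E.
Qed.

(** Along a coordinate line in P the square distance is a monic quadratic
  polynomial, so this is the second derivative test for the difference of
  Phi composed with that polynomial and of u. *)
Lemma touching_partial2 P c u z i (Phi Phi1 : R -> R) (l : R) :
  P i -> (forall x, has_partial i u x) -> has_partial i (partial i u) z ->
  (\forall X \near sqdist P c z, is_derive (X : R) (1 : R) Phi (Phi1 X)) ->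
  is_derive (sqdist P c z) 1 Phi1 l ->
  u z = Phi (sqdist P c z) ->
  (\forall h \near (0 : R), u (z + h *: basis_vec R i) <=
     Phi (sqdist P c (z + h *: basis_vec R i))) ->
  partial i (partial i u) z <=
    4 * (z ord0 i - c ord0 i) ^+ 2 * l + 2 * Phi1 (sqdist P c z).
Proof.
move=> Pi du ddu dPhi dPhi1 uz ule.
set Q := sqdist P c z; set b := 2 * (z ord0 i - c ord0 i).
set e := basis_vec R i.
pose q (h : R) : R := Q + b * h + h ^+ 2.
have dq (h : R) : is_derive h 1 q (b + 2 * h).
  by apply: is_derive_eq; rewrite /GRing.scale /=; ring.
have q0 : q 0 = Q by rewrite /q; ring.
have cq : q @ 0 --> Q by rewrite -q0; exact: is_derive_continuous (dq 0).
have z0 : z + (0 : R) *: e = z by rewrite scale0r addr0.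
rewrite -subr_ge0.
apply: (@second_derivative_min R (fun h => Phi (q h) - u (z + h *: e))
   (fun h => Phi1 (q h) * (b + 2 * h) - partial i u (z + h *: e)) 0).
- have dn : \forall h \near (0 : R), is_derive (q h) (1 : R) Phi (Phi1 (q h)) := cq _ dPhi.
  near=> h; have dh : is_derive (q h) 1 Phi (Phi1 (q h)) by near: h.
  have d1 := @is_derive_chain _ Phi q h _ _ dh (dq h).
  have d2 := is_derive_line (du (z + h *: e)).
  exact: is_deriveB.
- have d2 := @is_derive_line (partial i u) z i 0.
  rewrite -/e z0 in d2; have {}d2 := d2 ddu.
  have d1 : is_derive (0:R) 1 (fun h => Phi1 (q h)) (l * b).
    have h : is_derive (q 0) 1 Phi1 l by rewrite q0.
    have := is_derive_chain h (dq 0).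
    by rewrite mulr0 addr0.
  apply: is_derive_eq; rewrite /GRing.scale /= q0 /b; ring.
- near=> h; rewrite z0 q0 uz subrr subr_ge0.
  have : u (z + h *: e) <= Phi (sqdist P c (z + h *: e)) by near: h.
  by rewrite sqdist_line.
Unshelve. all: by end_near. Qed.

(** The right-hand side is the Laplacian of the radial function
  Phi(|x - c|^2), restricted to the coordinates in P. *)
Lemma touching_laplacian P c u z (Phi Phi1 : R -> R) (l : R) :
  (forall i x, has_partial i u x) -> (forall i, has_partial i (partial i u) z) ->
  (\forall X \near sqdist P c z, is_derive (X : R) (1 : R) Phi (Phi1 X)) ->
  is_derive (sqdist P c z) 1 Phi1 l ->
  u z = Phi (sqdist P c z) ->
  (forall i, P i -> \forall h \near (0 : R), u (z + h *: basis_vec R i) <=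
     Phi (sqdist P c (z + h *: basis_vec R i))) ->
  \sum_(i | P i) partial i (partial i u) z <=
    4 * sqdist P c z * l + 2 * #|P|%:R * Phi1 (sqdist P c z).
Proof.
move=> du ddu dPhi dPhi1 uz ule.
have -> : 4 * sqdist P c z * l + 2 * #|P|%:R * Phi1 (sqdist P c z) =
  \sum_(i | P i) (4 * (z ord0 i - c ord0 i) ^+ 2 * l + 2 * Phi1 (sqdist P c z)).
  rewrite big_split /= -mulr_suml -mulr_sumr sumr_const.
  by rewrite -mulr_natr /sqdist; ring.
apply: ler_sum => i Pi.
exact: (@touching_partial2 P c u z i Phi Phi1 l Pi (du i) (ddu i) dPhi dPhi1 uz (ule i Pi)).
Qed.

(** The contact is from above and only past times are compared, so the time
  derivative of u is at least that of the barrier B. *)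
Lemma touching_time (u : R -> R) (B : R -> R) (t l dB : R) :
  (u s - u t) / (s - t) @[s --> within [set s | s <= 0] t^'] --> l ->
  t <= 0 -> is_derive t 1 B dB -> u t = B t ->
  (\forall s \near t^'-, u s <= B s) -> dB <= l.
Proof.
move=> hu t0 /is_derive1_caratheodory[q [hq cq <-]] ut ule.
have cu : (u s - u t) / (s - t) @[s --> t^'-] --> l.
  apply: cvg_trans hu; apply: cvg_app => A hA.
  have {}hA : nbhs t (fun s => s != t -> s <= 0 -> A s) := hA.
  have : nbhs t (fun s => s < t -> A s).
    near=> s => st; have /= := near hA s; apply => //; first by rewrite lt_eqF.
    exact: le_trans (ltW st) t0.
  by [].
have cq' : q s @[s --> t^'-] --> q t.
  by apply: cvg_at_left_filter; exact: cq.
apply: (ler_cvg_to cq' cu).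
near=> s.
have st : s < t by near: s; exact: nbhs_left_lt.
rewrite ler_ndivlMr ?subr_lt0// -hq ut lerB//.
by near: s.
Unshelve. all: by end_near. Qed.

End Touching.

(** * The logistic front *)

Section LogisticFront.
Variable R : realType.
Implicit Types (v b : R -> R) (X s al gam g : R).

Lemma is_derive_affine_inv (k p q x : R) : p + q * x != 0 ->
  is_derive x 1 (fun y : R => k / (p + q * y)) (- (k * q) / (p + q * x) ^+ 2).
Proof.
move=> h; have d : is_derive x 1 (fun y : R => p + q * y) q.
  by apply: is_derive_eq; rewrite /GRing.scale /=; ring.
have di := @is_derive_inv _ (fun y : R => p + q * y) x _ h d.
by apply: is_derive_eq; rewrite /GRing.scale /=; field.
Qed.

Lemma is_derive_affine_inv2 (k p q x : R) : p + q * x != 0 ->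
  is_derive x 1 (fun y : R => - (k * q) / (p + q * y) ^+ 2)
    (2 * k * q ^+ 2 / (p + q * x) ^+ 3).
Proof.
move=> h; have d : is_derive x 1 (fun y : R => (p + q * y) ^+ 2) (2 * q * (p + q * x)).
  by apply: is_derive_eq; rewrite /GRing.scale /=; ring.
have h2 : (p + q * x) ^+ 2 != 0 by rewrite expf_neq0.
have di := @is_derive_inv _ (fun y : R => (p + q * y) ^+ 2) x _ h2 d.
by apply: is_derive_eq; rewrite /GRing.scale /=; field.
Qed.

Lemma is_derive_half_log X : 0 < X -> is_derive X 1 (fun x => ln x / 2) (2 * X)^-1.
Proof.
move=> X0; have d := is_derive1_ln X0.
by apply: is_derive_eq; rewrite /GRing.scale /=; field; rewrite gt_eqF.
Qed.

Lemma is_derive_log_chain (Om Om1 : R -> R) X :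
  (forall s : R, is_derive s (1 : R) Om (Om1 s)) -> 0 < X ->
  is_derive X 1 (fun x => Om (ln x / 2)) (Om1 (ln X / 2) / (2 * X)).
Proof.
move=> dOm X0.
exact: (@is_derive_chain _ Om (fun x => ln x / 2) X _ _ (dOm _) (is_derive_half_log X0)).
Qed.

Lemma is_derive_log_chain2 (Om1 : R -> R) X Om2 :
  is_derive (ln X / 2) 1 Om1 Om2 -> 0 < X ->
  is_derive X 1 (fun x => Om1 (ln x / 2) / (2 * x))
    ((Om2 - 2 * Om1 (ln X / 2)) / (4 * X ^+ 2)).
Proof.
move=> dOm X0.
have d1 := @is_derive_chain _ Om1 (fun x => ln x / 2) X _ _ dOm (is_derive_half_log X0).
have h : 0 + 2 * X != 0 by rewrite add0r mulf_neq0// ?gt_eqF// pnatr_eq0.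
have d2 := @is_derive_affine_inv 1 0 2 X h.
have -> : (fun x => Om1 (ln x / 2) / (2 * x)) =
   (fun x => (Om1 \o (fun x => ln x / 2)) x * (1 / (0 + 2 * x))).
  by apply/funext => x; rewrite add0r mul1r.
by apply: is_derive_eq; rewrite /GRing.scale /=; field; rewrite gt_eqF.
Qed.

(** The prefactor exp(-gam s), with s = ln X / 2 the logarithm of the radius
  and N = 2 gam + 2, is the Emden-Fowler change of unknown: it removes the
  first order term of the radial Laplacian 4 X Phi'' + 2 N Phi'. *)
Lemma emden_fowler_laplacian (W W1 : R -> R) gam (N : R) W2 X :
  0 < X -> N = 2 * gam + 2 -> (forall s : R, is_derive s (1 : R) W (W1 s)) ->
  is_derive (ln X / 2) 1 W1 W2 ->
  exists (Phi1 : R -> R) (l : R),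
   [/\ \forall x \near X, is_derive (x : R) (1 : R)
        (fun x => expR (- gam * (ln x / 2)) * W (ln x / 2)) (Phi1 x),
       is_derive X 1 Phi1 l &
       4 * X * l + 2 * N * Phi1 X =
         expR (- gam * (ln X / 2)) * (W2 - gam ^+ 2 * W (ln X / 2)) / X].
Proof.
move=> X0 NE dW dW1.
pose Om s := expR (- gam * s) * W s.
pose Om1 s := expR (- gam * s) * (W1 s - gam * W s).
have de s : is_derive s 1 (fun s => expR (- gam * s)) (- gam * expR (- gam * s)).
  have d : is_derive s 1 (fun s : R => - gam * s) (- gam).
    by apply: is_derive_eq; rewrite /GRing.scale /=; ring.
  have := @is_derive_chain _ expR (fun s => - gam * s) s _ _ (is_derive_expR _) d.
  by rewrite [X in is_derive _ _ _ X]mulrC.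
have dOm s : is_derive s 1 Om (Om1 s).
  have d1 := de s; have d2 := dW s.
  by apply: is_derive_eq; rewrite /GRing.scale /= /Om1; ring.
pose s := ln X / 2.
have dOm1 : is_derive s 1 Om1
    (expR (- gam * s) * (W2 - 2 * gam * W1 s + gam ^+ 2 * W s)).
  have d1 := de s; have d2 := dW s.
  have d3 : is_derive s 1 W1 W2 := dW1.
  by apply: is_derive_eq; rewrite /GRing.scale /=; ring.
exists (fun x => Om1 (ln x / 2) / (2 * x)); eexists; split.
- near=> x; have x0 : 0 < x by near: x; exact: lt_nbhsr.
  exact: (is_derive_log_chain dOm x0).
- exact: (is_derive_log_chain2 dOm1 X0).
- rewrite -/s /Om1 NE; field; rewrite ?gt_eqF//.
Unshelve. all: by end_near. Qed.

(** When b is a function of r with r' = v^(-2), the terms with v1 cancel in the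
  second derivative of v b; this is why the front is written in the variable
  r and not in s. *)
Lemma logistic_profile v v1 v2 b al :
  (forall s, 0 < v s) -> (forall s : R, is_derive s (1 : R) v (v1 s)) ->
  (forall s : R, is_derive s (1 : R) v1 (v2 s)) ->
  (forall s : R, is_derive s (1 : R) b (al * b s * (1 - 2 / 3 * b s) / v s ^+ 2)) ->
  let W1 s := v1 s * b s + al * b s * (1 - 2 / 3 * b s) / v s in
  (forall s : R, is_derive s (1 : R) (fun s => v s * b s) (W1 s)) /\
  (forall s : R, is_derive s (1 : R) W1 (v2 s * b s +
      al ^+ 2 * b s * (1 - 2 / 3 * b s) * (1 - 4 / 3 * b s) / v s ^+ 3)).
Proof.
move=> v0 dv dv1 db W1; split=> s.
  have d1 := dv s; have d2 := db s; apply: is_derive_eq.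
  by rewrite /GRing.scale /= /W1; field; rewrite gt_eqF.
have d1 := dv s; have d2 := dv1 s; have d3 := db s.
have vs : v s != 0 by rewrite gt_eqF.
have d4 := @is_derive_inv _ v s _ vs d1.
by apply: is_derive_eq; rewrite /GRing.scale /=; field; rewrite gt_eqF.
Qed.

Lemma logistic_derive v (r : R -> R) al g : 0 < g -> (forall s, 0 < v s) ->
  (forall s : R, is_derive s (1 : R) r (v s ^+ 2)^-1) ->
  let b s := 3 / 2 * expR (al * r s) / (expR (al * r s) + g) in
  forall s : R, is_derive s (1 : R) b (al * b s * (1 - 2 / 3 * b s) / v s ^+ 2).
Proof.
move=> g0 v0 dr b s.
have vs : v s != 0 by rewrite gt_eqF.
have E0 : expR (al * r s) + g != 0 by rewrite gt_eqF// addr_gt0// expR_gt0.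
have dE : is_derive s 1 (fun s => expR (al * r s)) (al * expR (al * r s) / v s ^+ 2).
  have d1 := dr s.
  have d : is_derive s 1 (fun s => al * r s) (al / v s ^+ 2).
    by apply: is_derive_eq; rewrite /GRing.scale /=; ring.
  have := @is_derive_chain _ expR (fun s => al * r s) s _ _ (is_derive_expR _) d.
  by congr is_derive; ring.
have dD : is_derive s 1 (fun s => expR (al * r s) + g) (al * expR (al * r s) / v s ^+ 2).
  by apply: is_derive_eq; rewrite addr0.
have d4 := @is_derive_inv _ (fun s => expR (al * r s) + g) s _ E0 dD.
apply: is_derive_eq; rewrite /GRing.scale /= /b; field.
by rewrite E0 vs.
Qed.

(** The key inequality. The left-hand side is the second derivative of the
  logistic front divided by b, with a margin al^2/60. For b <= 9/10 the
  absorption on the right is bounded below, and a small al suffices. For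
  9/10 < b <= 1 the absorption may vanish, but 1 - (4/3) b is negative. *)
Lemma logistic_supersolution (al m V b q : R) :
  0 < al -> 0 < m -> m <= V -> 0 < b -> b <= 1 -> 0 < q ->
  2 * al ^+ 2 <= m * (1 - (9 / 10) `^ q) ->
  al ^+ 2 * (1 - 2 / 3 * b) * (1 - 4 / 3 * b) + al ^+ 2 / 60 < V * (1 - b `^ q).
Proof.
move=> al0 m0 mV b0 b1 q0 hal.
have A0 : 0 < al ^+ 2 by rewrite exprn_gt0.
have [b9|b9] := leP b (9 / 10).
  have bq : b `^ q <= (9 / 10) `^ q by rewrite ge0_ler_powR// ?nnegrE ltW//.
  have h : 2 * al ^+ 2 <= V * (1 - b `^ q).
    have h0 : 0 <= 1 - (9 / 10) `^ q.
      by rewrite -(pmulr_rge0 _ m0); apply: (le_trans _ hal); rewrite mulr_ge0// ltW.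
    apply: (le_trans hal); apply: ler_pM => //; first exact: ltW.
    by rewrite lerB.
  apply: lt_le_trans h; rewrite -mulrA.
  have : (1 - 2 / 3 * b) * (1 - 4 / 3 * b) <= 1 by nra.
  move=> /(ler_wpM2l (ltW A0)); lra.
have bq : b `^ q <= 1 by have := ge0_ler_powR (ltW q0) (ltW b0) ler01 b1; rewrite powR1.
have : 0 <= V * (1 - b `^ q) by rewrite mulr_ge0// ?subr_ge0//; lra.
apply: lt_le_trans; rewrite -mulrA.
have : (1 - 2 / 3 * b) * (1 - 4 / 3 * b) <= - (2 / 25) by nra.
move=> /(ler_wpM2l (ltW A0)); lra.
Qed.

(** X is the square radius, K E^2 its bound behind the front, and the bracket
  collects the derivatives of the front in y and t. Multiplied by (E + g)^2
  they are of order (a L)^2, because E + g <= 3 g <= 3 a L^2. *)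
Lemma slow_front (a L eta Y M X E g K : R) : 0 < a -> 0 < L -> a * L <= eta ->
  0 <= Y -> Y <= L ^+ 2 -> 0 <= M -> 0 < E -> 0 < X -> X <= K * E ^+ 2 ->
  E <= 2 * g -> 0 < g -> g <= a * L ^+ 2 ->
  X * (8 * Y * a ^+ 2 / (E + g) ^+ 2 + (2 * M + 1) * a / (E + g)) <=
    K * ((11 + 6 * M) * eta ^+ 2).
Proof.
move=> a0 L0 aL Y0 YL M0 E0 X0 XK Eg g0 gL; set d := E + g.
have d0 : 0 < d by rewrite addr_gt0.
have K0 : 0 <= K.
  by rewrite -(@pmulr_lge0 _ (E ^+ 2)) ?exprn_gt0//; apply: le_trans XK; exact: ltW.
have L2 : a ^+ 2 * L ^+ 2 <= eta ^+ 2.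
  have aL0 : 0 < a * L by exact: mulr_gt0.
  by rewrite -exprMn lerXn2r ?nnegrE ?(ltW aL0)// ltW// (lt_le_trans aL0).
have Xd : X <= K * d ^+ 2.
  apply: (le_trans XK); rewrite ler_wpM2l//.
  by rewrite lerXn2r ?nnegrE ?(ltW E0) ?(ltW d0)// lerDl ltW.
have -> : 8 * Y * a ^+ 2 / d ^+ 2 + (2 * M + 1) * a / d =
   (8 * Y * a ^+ 2 + (2 * M + 1) * (a * d)) / d ^+ 2 by field; rewrite gt_eqF.
have d20 : 0 < d ^+ 2 by rewrite exprn_gt0.
rewrite mulrA ler_pdivrMr//.
have Ya : Y * a ^+ 2 <= eta ^+ 2.
  by apply: (le_trans _ L2); rewrite mulrC ler_pM2l ?exprn_gt0.
have ad : a * d <= 3 * eta ^+ 2.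
  have : a * d <= a * (3 * (a * L ^+ 2)) by rewrite ler_pM2l// /d; lra.
  have -> : a * (3 * (a * L ^+ 2)) = 3 * (a ^+ 2 * L ^+ 2) by ring.
  lra.
have h : 8 * Y * a ^+ 2 + (2 * M + 1) * (a * d) <= (11 + 6 * M) * eta ^+ 2.
  have : (2 * M + 1) * (a * d) <= (2 * M + 1) * (3 * eta ^+ 2) by rewrite ler_wpM2l//; lra.
  lra.
have -> : K * ((11 + 6 * M) * eta ^+ 2) * d ^+ 2 =
  (K * d ^+ 2) * ((11 + 6 * M) * eta ^+ 2) by ring.
apply: ler_pM => //; first exact: ltW.
by apply: addr_ge0; [apply: mulr_ge0; [lra|exact: sqr_ge0]|
    apply: mulr_ge0; [lra|apply: ltW; exact: mulr_gt0]].
Qed.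

(** The function y / (3/2 - y) inverts the logistic function, so comparing y with
  the front amounts to comparing this quantity with e / g. *)
Lemma logistic_le (y e g : R) : y <= 1 -> 0 < e -> 0 < g ->
  (y / (3 / 2 - y) * (g / e) <= 1) = (y <= 3 / 2 * e / (e + g)).
Proof.
move=> y1 e0 g0; have y3 : 0 < 3 / 2 - y by lra.
rewrite mulf_div ler_pdivrMr ?mulr_gt0// mul1r ler_pdivlMr ?addr_gt0//.
by rewrite -subr_ge0 -[in RHS]subr_ge0; congr (0 <= _); ring.
Qed.

Lemma logistic_eq (y e g : R) : y <= 1 -> 0 < e -> 0 < g ->
  y / (3 / 2 - y) * (g / e) = 1 -> y = 3 / 2 * e / (e + g).
Proof.
move=> y1 e0 g0 h; have y3 : 0 < 3 / 2 - y by lra.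
have eg : 0 < e + g by exact: addr_gt0.
have : y * g = e * (3 / 2 - y).
  move: h => /(congr1 (fun x => x * ((3 / 2 - y) * e))); rewrite mul1r.
  have -> : y / (3 / 2 - y) * (g / e) * ((3 / 2 - y) * e) = y * g.
    move: (3 / 2 - y) y3 => D D0; have Dn := lt0r_neq0 D0; have en := lt0r_neq0 e0.
    by field; rewrite Dn en.
  by move=> ->; ring.
move=> h2; apply: (mulIf (lt0r_neq0 eg)); rewrite divfK ?gt_eqF//; lra.
Qed.

End LogisticFront.

(** * Ancient solutions and compact shells *)

Section Setting.
Variables (R : realType) (n : nat).
Implicit Types (P : pred 'I_n) (c z : 'rV[R]_n).

(** The common setting of both parts: a classical ancient solution with the
  regularity that the comparison uses. The time derivative is a separate
  argument so that it can be 0 for a stationary solution. *)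
Definition past_solution (p : R) (u ut : 'rV[R]_n -> R -> R) : Prop :=
  [/\ continuous_past u,
      forall i x t, t <= 0 -> has_partial i (u^~ t) x,
      forall i x t, t <= 0 -> has_partial i (partial i (u^~ t)) x,
      forall x t, t <= 0 ->
        time_quotient u x t s @[s --> within [set s | s <= 0] t^'] --> ut x t &
      forall x t, t <= 0 ->
        ut x t = laplacian (u^~ t) x + power_nonlin p (u x t)].

Definition others P : pred 'I_n := fun i => ~~ P i.

Definition radial_log P z : R := ln (sqdist P 0 z) / 2.

Definition barrier (gam : R) (v E : R -> R) (s g : R) : R :=
  expR (- gam * s) * (v s * (3 / 2 * E s / (E s + g))).

(** The position of the front; it is positive in a paraboloid with vertex at
  time t0 - L^2 above the points with the same y coordinates as c. *)
Definition front P c (a L t0 : R) z (t : R) : R :=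
  a * (L ^+ 2 - sqdist (others P) c z + (t - t0)).

Lemma near_line_quadratic (A B : R) : 0 < A ->
  \forall h \near (0 : R), 0 < A + B * h + h ^+ 2.
Proof.
move=> A0.
have c : (A + B * h + h ^+ 2) @[h --> (0 : R)] --> A + B * 0 + 0 ^+ 2.
  have dq : is_derive (0 : R) 1 (fun h => A + B * h + h ^+ 2) B.
    by apply: is_derive_eq; rewrite /GRing.scale /=; ring.
  exact: (is_derive_continuous dq).
by apply: (cvgr_gt _ c); rewrite mulr0 addr0 expr0n addr0.
Qed.

Lemma sqdist_continuous P c : continuous (sqdist P c).
Proof.
move=> z; apply: (@continuous_big R 'I_n +%R 0 P) => //.
  by move=> x; exact: add_continuous.
move=> i _ x; apply: (@continuous_comp _ _ _ (fun z : 'rV[R]_n => z ord0 i - c ord0 i)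
  (fun y : R => y ^+ 2)); last exact: exprn_continuous.
by apply: continuousB; [exact: coord_continuous|exact: cst_continuous].
Qed.

Lemma compact_shell P c (del rho K : R) :
  compact [set z | del <= sqdist P 0 z <= rho /\ sqdist (others P) c z <= K].
Proof.
pose lo i := if P i then - (rho + 1) else c ord0 i - (K + 1).
pose hi i := if P i then rho + 1 else c ord0 i + (K + 1).
have cbox := @rV_compact R n (fun i => `[lo i, hi i]%classic)
  (fun i => @segment_compact R _ _).
apply: subclosed_compact cbox _.
  have -> : [set z | del <= sqdist P 0 z <= rho /\ sqdist (others P) c z <= K] =
    (sqdist P 0 @^-1` [set x | del <= x]) `&` (sqdist P 0 @^-1` [set x | x <= rho])
      `&` (sqdist (others P) c @^-1` [set x | x <= K]).
    by apply/seteqP; split=> z /= => [[/andP[? ?] ?]|[[-> ->] ?]].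
  apply: closedI; first apply: closedI.
  - apply: preimage_closed; [by move=> z _; exact: sqdist_continuous|exact: closed_ge].
  - apply: preimage_closed; [by move=> z _; exact: sqdist_continuous|exact: closed_le].
  - apply: preimage_closed; [by move=> z _; exact: sqdist_continuous|exact: closed_le].
have coord (Q : pred 'I_n) (d z : 'rV[R]_n) (k : R) i : Q i -> sqdist Q d z <= k ->
    d ord0 i - (k + 1) <= z ord0 i <= d ord0 i + (k + 1).
  move=> Qi; rewrite /sqdist (bigD1 i)//= => h.
  have : (z ord0 i - d ord0 i) ^+ 2 <= k.
    apply: le_trans h; rewrite lerDl; apply: sumr_ge0 => j _; exact: sqr_ge0.
  move: (z ord0 i) (d ord0 i) => x y; clear => h.
  have h1 := sqr_ge0 (x - y - 1 / 2); have h2 := sqr_ge0 (x - y + 1 / 2).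
  by apply/andP; split; nra.
move=> z [/andP[_ zr] zK] i /=; rewrite in_itv /= /lo /hi.
case: ifPn => Pi.
  by have := coord P 0 z rho i Pi zr; rewrite !mxE sub0r add0r.
exact: (coord (others P) c z K i Pi zK).
Qed.

End Setting.

(** * Comparison with the front *)

Section FrontComparison.
Variables (R : realType) (n N : nat) (P : pred 'I_n).
Variables (gam al m Mx mn : R) (v v1 v2 r : R -> R).
Variables (u ut : 'rV[R]_n -> R -> R).
Implicit Types (c z : 'rV[R]_n) (s t : R).
Let p := pS R N.
Let E s := expR (al * r s).
Let X : 'rV[R]_n -> R := sqdist P 0.
Let M := #|others P|%:R : R.
Let psi s := expR (- gam * s) * v s.
Hypothesis (N2 : (2 < N)%N) (cP : #|P| = N) (gamE : gam = (N%:R - 2) / 2).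
Hypothesis (v0 : forall s, 0 < v s).
Hypothesis (dv : forall s : R, is_derive s (1 : R) v (v1 s)).
Hypothesis (dv1 : forall s : R, is_derive s (1 : R) v1 (v2 s)).
Hypothesis (ode : forall s, v2 s = gam ^+ 2 * v s - v s `^ p).
Hypothesis (dr : forall s : R, is_derive s (1 : R) r (v s ^+ 2)^-1).
Hypothesis (r0 : r 0 = 0).
Hypothesis (mn0 : 0 < mn) (vm : forall s, mn <= v s) (vM : forall s, v s <= Mx).
Hypothesis (m0 : 0 < m) (hm : forall s, m <= v s `^ (p - 1) * v s ^+ 4).
Hypothesis (al0 : 0 < al) (hal : 2 * al ^+ 2 <= m * (1 - (9 / 10) `^ (p - 1))).
(* al1 bounds |x| and al2 bounds |x|^(gam/2) by E near x = 0 *)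
Hypothesis (al1 : al <= mn ^+ 2) (al2 : al <= gam / 2 * mn ^+ 2).
Hypothesis (sol : past_solution p u ut).
Hypothesis (ule : forall z t, 0 < X z -> t <= 0 ->
  u z t <= psi (radial_log P z)).

Let gam0 : 0 < gam.
Proof. by rewrite gamE divr_gt0// subr_gt0 ltr_nat. Qed.

Let E0 s : 0 < E s. Proof. exact: expR_gt0. Qed.

(** At a contact point the equation, the touching lemmas and the bounds on the
  front contradict the strict inequality of [logistic_supersolution]. *)
Lemma no_contact c (L t0 S eta a t : R) z :
  let s : R := radial_log P z in let g : 'rV[R]_n -> R -> R := front P c a L t0 in
  0 < eta -> Mx ^+ 4 * expR (2 * S) * (11 + 6 * M) * eta ^+ 2 <= al ^+ 2 / 60 ->
  0 < L -> 0 < a -> a * L <= eta -> t <= t0 -> t0 <= 0 ->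
  0 < X z -> 0 < g z t -> expR (2 * s) <= expR (2 * S) * E s ^+ 2 ->
  u z t = barrier gam v E s (g z t) -> E s <= 2 * g z t ->
  (forall z' t', t' <= t -> 0 < X z' -> 0 < g z' t' ->
     u z' t' <= barrier gam v E (radial_log P z') (g z' t')) ->
  False.
Proof.
move=> s g eta0 heta L0 a0 aL tt0 t00 X0 g0 ES ub Eg below.
have [_ du ddu dut eq] := sol.
have t_le0 : t <= 0 by exact: le_trans tt0 t00.
rewrite /X in X0 below; set Xz := sqdist P 0 z in X0; set Y := sqdist (others P) c z.
have gE : g z t = a * (L ^+ 2 - Y + (t - t0)) by [].
set gz := g z t in g0 gE ub Eg.
set Es := E s in ES Eg; have Es0 : 0 < Es by exact: expR_gt0.
set d := Es + gz; have d0 : 0 < d by rewrite addr_gt0.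
set ps := expR (- gam * s); have ps0 : 0 < ps by exact: expR_gt0.
set b := 3 / 2 * Es / d.
have uE : u z t = ps * (v s * b) by rewrite ub.
have b0 : 0 < b by rewrite divr_gt0// mulr_gt0//; lra.
have b1 : b <= 1 by rewrite ler_pdivrMr// mul1r /d; lra.
have vs0 := v0 s.
have NE : N%:R = 2 * gam + 2 :> R by rewrite gamE; field.
have db := logistic_derive al g0 v0 dr.
have [dW dW1] := logistic_profile v0 dv dv1 db.
have [Phi1 [l [dPhi dPhi1 lapE]]] := emden_fowler_laplacian X0 NE dW (dW1 _).
have lapx : \sum_(i | P i) partial i (partial i (u^~ t)) z <=
    4 * Xz * l + 2 * #|P|%:R * Phi1 Xz.
  apply: (@touching_laplacian R n P 0 (u^~ t) z _ Phi1 l _ _ dPhi dPhi1).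
  - by move=> i x; exact: du.
  - by move=> i; exact: ddu.
  - exact: uE.
  move=> i Pi.
  have hX := @near_line_quadratic R Xz (2 * (z ord0 i - (0 : 'rV[R]_n) ord0 i)) X0.
  near=> h.
  have Pi' : ~~ others P i by rewrite /others negbK.
  have gh : g (z + h *: basis_vec R i) t = gz.
    by rewrite /gz /g /front sqdist_line_out.
  have /below : t <= t by [].
  move=> /(_ (z + h *: basis_vec R i)); rewrite gh; apply=> //.
  by rewrite sqdist_line//; near: h.
rewrite cP lapE in lapx.
pose k := ps * (v s * (3 / 2 * Es)).
have kE : k = ps * (v s * b) * d by rewrite /k /b; field; rewrite gt_eqF.
have dd : d = (Es + a * (L ^+ 2 + (t - t0))) + (- a) * Y by rewrite /d gE; ring.
have lapy : \sum_(i | others P i) partial i (partial i (u^~ t)) z <=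
    4 * Y * (2 * k * a ^+ 2 / d ^+ 3) + 2 * M * (k * a / d ^+ 2).
  pose Q := Es + a * (L ^+ 2 + (t - t0)).
  have Qd x : 0 < a * (L ^+ 2 - x + (t - t0)) -> Q + - a * x != 0.
    move=> h; have -> : Q + - a * x = Es + a * (L ^+ 2 - x + (t - t0)) by rewrite /Q; ring.
    by rewrite gt_eqF// addr_gt0.
  have cg : a * (L ^+ 2 - x + (t - t0)) @[x --> Y] --> a * (L ^+ 2 - Y + (t - t0)).
    have dq : is_derive Y 1 (fun x => a * (L ^+ 2 - x + (t - t0))) (- a).
      by apply: is_derive_eq; rewrite /GRing.scale /=; ring.
    exact: (is_derive_continuous dq).
  have -> : 4 * Y * (2 * k * a ^+ 2 / d ^+ 3) + 2 * M * (k * a / d ^+ 2) =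
     4 * Y * (2 * k * (- a) ^+ 2 / (Q + - a * Y) ^+ 3) +
     2 * M * (- (k * (- a)) / (Q + - a * Y) ^+ 2).
    by rewrite -dd; field; rewrite gt_eqF.
  have QY : Q + - a * Y != 0 by apply: Qd; rewrite -gE.
  apply: (@touching_laplacian R n (others P) c (u^~ t) z
     (fun x => k / (Q + (- a) * x)) (fun x => - (k * (- a)) / (Q + - a * x) ^+ 2)
     (2 * k * (- a) ^+ 2 / (Q + - a * Y) ^+ 3)).
  - by move=> i x; exact: du.
  - by move=> i; exact: ddu.
  - near=> x; apply: is_derive_affine_inv; apply: Qd.
    by near: x; apply: (cvgr_gt _ cg); rewrite -gE.
  - exact: is_derive_affine_inv2.
  - by rewrite -dd uE kE; field; rewrite gt_eqF.
  move=> i Pi.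
  have hY : \forall h \near (0 : R), 0 < g (z + h *: basis_vec R i) t.
    pose q (h : R) := a * (L ^+ 2 - (Y + 2 * (z ord0 i - c ord0 i) * h + h ^+ 2) + (t - t0)).
    have dq : is_derive (0 : R) 1 q (a * - (2 * (z ord0 i - c ord0 i))).
      by apply: is_derive_eq; rewrite /GRing.scale /=; ring.
    have cq : q h @[h --> (0 : R)] --> q 0 := is_derive_continuous dq.
    have q0 : 0 < q 0 by rewrite /q mulr0 expr0n !addr0 -gE.
    near=> h; rewrite /g /front sqdist_line//.
    by near: h; exact: (cvgr_gt _ cq _ q0).
  near=> h.
  have Pi' : ~~ P i by [].
  have Xh : sqdist P 0 (z + h *: basis_vec R i) = Xz by rewrite sqdist_line_out.
  have gh : 0 < g (z + h *: basis_vec R i) t by near: h.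
  have /below := lexx t; move=> /(_ (z + h *: basis_vec R i)).
  rewrite Xh => /(_ X0 gh); rewrite /radial_log Xh -/(radial_log P z) -/s.
  move=> /le_trans; apply; rewrite /barrier -/ps -/Es.
  have -> : g (z + h *: basis_vec R i) t =
     a * (L ^+ 2 - sqdist (others P) c (z + h *: basis_vec R i) + (t - t0)) by [].
  rewrite le_eqVlt; apply/orP; left; apply/eqP; rewrite /k /Q.
  by rewrite !mulrA; congr (_ / _); ring.
have timele : - (k * a) / d ^+ 2 <= ut z t.
  pose Q := Es + a * (L ^+ 2 - Y - t0).
  have dE : Q + a * t = d by rewrite /d gE /Q; ring.
  have Qt : Q + a * t != 0 by rewrite dE gt_eqF.
  apply: (@touching_time R (u z) (fun s => k / (Q + a * s)) t (ut z t) _ (dut _ _ _)) => //.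
  - by have := @is_derive_affine_inv R k Q a t Qt; rewrite dE.
  - by rewrite dE uE kE; field; rewrite gt_eqF.
  have cg : a * (L ^+ 2 - Y + (x - t0)) @[x --> t^'-] --> gz.
    rewrite gE; apply: cvg_at_left_filter.
    have dq : is_derive t 1 (fun x => a * (L ^+ 2 - Y + (x - t0))) a.
      by apply: is_derive_eq; rewrite /GRing.scale /=; ring.
    exact: (is_derive_continuous dq).
  near=> x.
  have xt : x <= t by near: x; exact: nbhs_left_le.
  have gx : 0 < g z x by near: x; exact: (cvgr_gt _ cg).
  apply: (le_trans (below z x xt X0 gx)); rewrite /barrier -/s -/ps -/Es.
  have -> : g z x = a * (L ^+ 2 - Y + (x - t0)) by [].
  rewrite le_eqVlt; apply/orP; left; apply/eqP; rewrite /k /Q.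
  by rewrite !mulrA; congr (_ / _); ring.
have pE : p - 1 = 2 / gam.
  have -> : p = (2 * gam + 4) / (2 * gam).
    by rewrite /p /pS NE; congr (_ / _); ring.
  by field; rewrite gt_eqF.
have p10 : 0 < p - 1 by rewrite pE divr_gt0.
set w := v s `^ (p - 1); set be := b `^ (p - 1).
have XE : Xz = expR (2 * s).
  have -> : 2 * s = ln Xz by rewrite /s /radial_log -/Xz; field.
  by rewrite lnK.
have psip : ps `^ (p - 1) = Xz^-1.
  by rewrite XE -expRN /ps -expRM pE; congr expR; field; rewrite gt_eqF.
have nl : power_nonlin p (u z t) = Xz^-1 * w * be * (ps * (v s * b)).
  have vb0 : 0 < v s * b by exact: mulr_gt0.
  have u0 : 0 < ps * (v s * b) by exact: mulr_gt0.
  rewrite /power_nonlin uE gtr0_norm//.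
  by rewrite powRM ?(ltW ps0) ?(ltW vb0)// powRM ?(ltW vs0) ?(ltW b0)// psip !mulrA.
have v2E : v2 s = gam ^+ 2 * v s - v s * w.
  have p0 : 0 < p by rewrite -(subrK 1 p) addr_gt0.
  by rewrite ode /w mulr_powRB1// ltW.
have lapE2 : laplacian (u^~ t) z = \sum_(i | P i) partial i (partial i (u^~ t)) z +
   \sum_(i | others P i) partial i (partial i (u^~ t)) z.
  by rewrite /laplacian (bigID P).
have key : ut z t = \sum_(i | P i) partial i (partial i (u^~ t)) z +
   \sum_(i | others P i) partial i (partial i (u^~ t)) z +
   Xz^-1 * w * be * (ps * (v s * b)) by rewrite eq// lapE2 nl.
(* Sg is the sum of all the terms, divided by the positive factor of SgE: the
   equation makes it nonnegative. *)
pose Sg := al ^+ 2 * (1 - 2 / 3 * b) * (1 - 4 / 3 * b) - w * v s ^+ 4 * (1 - be)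
   + Xz * v s ^+ 4 * (8 * Y * a ^+ 2 / d ^+ 2 + (2 * M + 1) * a / d).
have SgE : ps * b / (Xz * v s ^+ 3) * Sg =
   ps * (v2 s * b + al ^+ 2 * b * (1 - 2 / 3 * b) * (1 - 4 / 3 * b) / v s ^+ 3
      - gam ^+ 2 * (v s * b)) / Xz +
   (4 * Y * (2 * k * a ^+ 2 / d ^+ 3) + 2 * M * (k * a / d ^+ 2)) +
   Xz^-1 * w * be * (ps * (v s * b)) - - (k * a) / d ^+ 2.
  have [Xn dn vn] : [/\ Xz != 0, d != 0 & v s != 0] by rewrite !gt_eqF.
  rewrite v2E kE /Sg; field.
  by rewrite Xn dn vn.
have Sg0 : 0 <= Sg.
  have T0 : 0 < ps * b / (Xz * v s ^+ 3) by apply: divr_gt0; apply: mulr_gt0 => //; exact: exprn_gt0.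
  rewrite -(pmulr_rge0 _ T0) SgE subr_ge0.
  apply: (le_trans timele); rewrite key lerD2r; exact: (lerD lapx lapy).
have reac := logistic_supersolution al0 m0 (hm s) b0 b1 p10 hal.
have YL : Y <= L ^+ 2.
  have : 0 < L ^+ 2 - Y + (t - t0) by rewrite -(pmulr_rgt0 _ a0) -gE.
  move=> h; rewrite -subr_ge0; apply: le_trans (ltW h) _.
  by rewrite gerDl subr_le0.
have gL : gz <= a * L ^+ 2.
  rewrite gE ler_pM2l// -addrA gerDl -[leRHS]addr0 lerD ?subr_le0//.
  by rewrite oppr_le0; exact: sqdist_ge0.
have M0 : 0 <= M by exact: ler0n.
have h1 : Xz * (8 * Y * a ^+ 2 / d ^+ 2 + (2 * M + 1) * a / d) <=
    expR (2 * S) * ((11 + 6 * M) * eta ^+ 2).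
  have ES' : Xz <= expR (2 * S) * Es ^+ 2 by rewrite XE.
  exact: (slow_front a0 L0 aL (sqdist_ge0 _ _ _) YL M0 Es0 X0 ES' Eg g0 gL).
have front0 : 0 <= 8 * Y * a ^+ 2 / d ^+ 2 + (2 * M + 1) * a / d.
  have M1 : 0 <= 2 * M + 1 by rewrite addr_ge0// mulr_ge0.
  apply: addr_ge0; apply: divr_ge0; rewrite ?sqr_ge0 ?(ltW d0)//.
    by apply: mulr_ge0; [apply: mulr_ge0 => //; exact: sqdist_ge0|exact: sqr_ge0].
  by apply: mulr_ge0 => //; exact: ltW.
have h2 : Xz * v s ^+ 4 * (8 * Y * a ^+ 2 / d ^+ 2 + (2 * M + 1) * a / d) <= al ^+ 2 / 60.
  apply: (le_trans _ heta).
  have -> : Xz * v s ^+ 4 * (8 * Y * a ^+ 2 / d ^+ 2 + (2 * M + 1) * a / d) =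
    v s ^+ 4 * (Xz * (8 * Y * a ^+ 2 / d ^+ 2 + (2 * M + 1) * a / d)) by ring.
  have -> : Mx ^+ 4 * expR (2 * S) * (11 + 6 * M) * eta ^+ 2 =
    Mx ^+ 4 * (expR (2 * S) * ((11 + 6 * M) * eta ^+ 2)) by ring.
  apply: ler_pM => //; first by rewrite exprn_ge0// ltW.
    by apply: mulr_ge0 => //; exact: ltW.
  by rewrite lerXn2r ?nnegrE ?(ltW vs0)//; apply: le_trans (vM s); exact: ltW.
have : Sg < 0.
  rewrite /Sg addrAC subr_lt0; apply: le_lt_trans reac.
  by rewrite lerD2l.
by rewrite ltNge Sg0.
Unshelve. all: by end_near. Qed.

Lemma increment_r a b : a < b ->
  exists2 c, mn <= v c <= Mx & r b - r a = (v c ^+ 2)^-1 * (b - a).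
Proof.
move=> ab.
have cr : {within `[a, b], continuous r}.
  by apply: derivable_within_continuous => x _; case: (dr x).
have [c _ ->] := @MVT R r (fun s => (v s ^+ 2)^-1) a b ab (fun x _ => dr x) cr.
by exists c => //; rewrite vm vM.
Qed.

Lemma growth_increasing a b : a < b -> E a < E b.
Proof.
move=> ab; rewrite /E ltr_expR ltr_pM2l// -subr_gt0.
have [c _ ->] := increment_r ab.
by rewrite mulr_gt0 ?subr_gt0// invr_gt0 exprn_gt0.
Qed.

Lemma growth0 : E 0 = 1. Proof. by rewrite /E r0 mulr0 expR0. Qed.

(** Since 0 >= r(s) >= s / mn^2 for s <= 0, a small al makes E decay slower at
  the singularity than a given positive power of |x|. *)
Lemma growth_lower k s : al <= k * mn ^+ 2 -> s <= 0 -> expR (k * s) <= E s.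
Proof.
move=> hk; rewrite le_eqVlt => /orP[/eqP->|s0]; first by rewrite mulr0 growth0 expR0.
rewrite /E ler_expR; have [c /andP[cm _]] := increment_r s0.
rewrite r0 !sub0r => /eqP; rewrite eqr_oppLR mulrN opprK => /eqP ->.
have v20 : 0 < v c ^+ 2 by rewrite exprn_gt0.
rewrite mulrA ler_nM2r// ler_pdivrMr//.
apply: (le_trans hk); have k0 : 0 <= k.
  have mn20 : 0 < mn ^+ 2 by rewrite exprn_gt0.
  by rewrite -(pmulr_lge0 _ mn20) (le_trans _ hk)// ltW.
by rewrite ler_wpM2l// lerXn2r ?nnegrE ?(ltW mn0)// ltW.
Qed.

Lemma growth_unbounded s : 0 < s -> 1 + al / Mx ^+ 2 * s <= E s.
Proof.
move=> s0; apply: le_trans (expR_ge1Dx _); rewrite lerD2l.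
have [c /andP[cm cM]] := increment_r s0; rewrite r0 !subr0 => ->.
rewrite -!mulrA ler_pM2l// ler_pM2r//.
have Mx0 : 0 < Mx by apply: lt_le_trans (vM 0).
by rewrite lef_pV2 ?posrE ?exprn_gt0// lerXn2r ?nnegrE ?(ltW Mx0)// ltW.
Qed.

Lemma growth_dominates S s : 0 <= S -> s <= S -> expR (2 * s) <= expR (2 * S) * E s ^+ 2.
Proof.
move=> S0 sS; rewrite !expRM_natl -exprMn lerXn2r ?nnegrE ?expR_ge0 ?mulr_ge0 ?expR_ge0//.
have [s0|s0] := leP s 0.
  have h := @growth_lower 1 s; rewrite !mul1r in h; have {}h := h al1 s0.
  apply: (le_trans h); rewrite -[leLHS]mul1r ler_pM2r//.
  by rewrite -expR0 ler_expR.
have E1 : 1 <= E s by rewrite -growth0 ltW// growth_increasing.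
by rewrite -[leLHS]mulr1 ler_pM ?expR_ge0// ler_expR.
Qed.

Let psi0 s : 0 < psi s. Proof. by rewrite mulr_gt0 ?expR_gt0. Qed.

Lemma growth_continuous : continuous E.
Proof.
move=> s; have d : is_derive s 1 (fun s => al * r s) (al * (v s ^+ 2)^-1).
  by have d := dr s; apply: is_derive_eq; rewrite /GRing.scale /=; ring.
exact: is_derive_continuous (@is_derive_chain _ expR (fun s => al * r s) s _ _ (is_derive_expR _) d).
Qed.

Lemma psi_continuous : continuous psi.
Proof.
move=> s.
apply: (@continuousM _ _ (fun s => expR (- gam * s)) v s); last exact: is_derive_continuous (dv s).
have d : is_derive s 1 (fun s : R => - gam * s) (- gam).
  by apply: is_derive_eq; rewrite /GRing.scale /=; ring.
exact: is_derive_continuous (@is_derive_chain _ expR (fun s => - gam * s) s _ _ (is_derive_expR _) d).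
Qed.

Lemma radial_continuous (F : R -> R) (x : 'rV[R]_n * R) : continuous F ->
  0 < X x.1 -> {for x, continuous (fun x => F (radial_log P x.1))}.
Proof.
move=> cF X0.
have cX : {for x, continuous (X \o fst)}.
  by apply: continuous_comp; [exact: cvg_fst|exact: sqdist_continuous].
have cs : {for x, continuous ((fun y => ln y / 2) \o (X \o fst))}.
  apply: continuous_comp; first exact: cX.
  exact: is_derive_continuous (is_derive_half_log X0).
exact: (@continuous_comp _ _ _ _ F x cs (cF _)).
Qed.

Lemma front_continuous c a L t0 :
  continuous (fun x : 'rV[R]_n * R => front P c a L t0 x.1 x.2).
Proof.
move=> x; have cY : {for x, continuous (fun x : 'rV[R]_n * R => sqdist (others P) c x.1)}.
  apply: (@continuous_comp _ _ _ fst (sqdist (others P) c)); first exact: cvg_fst.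
  exact: sqdist_continuous.
have ct : {for x, continuous (fun x : 'rV[R]_n * R => x.2)} by exact: cvg_snd.
apply: (@continuousM _ _ (fun=> a) (fun x : 'rV[R]_n * R =>
  L ^+ 2 - sqdist (others P) c x.1 + (x.2 - t0)) x); first exact: cst_continuous.
by apply: cvgD; apply: cvgB => //; exact: cvg_cst.
Qed.

Lemma compact_bound (K : set 'rV[R]_n) (T : R) : compact K ->
  exists2 C : R, 0 < C & forall z t, K z -> T <= t <= 0 -> u z t <= C.
Proof.
move=> cK; have cD : compact (K `*` `[T, 0]%classic).
  by apply: compact_setX => //; exact: segment_compact.
have [cu _ _ _ _] := sol.
have cuD : {within K `*` `[T, 0]%classic, continuous (fun x : 'rV[R]_n * R => u x.1 x.2)}.
  apply: continuous_subspaceW cu => x [_ /=]; by rewrite in_itv /= => /andP[].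
have /compact_bounded[C [_ hC]] := continuous_compact cuD cD.
exists (`|C| + 1); first by rewrite ltr_wpDl.
move=> z t Kz tT.
have CC : C < `|C| + 1 by apply: (le_lt_trans (ler_norm C)); rewrite ltrDl.
have h : `|u z t| <= `|C| + 1.
  by apply: (hC _ CC (u z t)); exists (z, t) => //=; split => //=; rewrite in_itv.
exact: (le_trans (ler_norm (u z t)) h).
Qed.

(** The factor E S / 2 is the value a L^2 of the front position at the point
  itself; eta, the value of a L, is chosen small depending on S, and this
  determines L. The maximum of H over the compact set D would be a contact point if it
  exceeded 1. *)
Lemma upper_estimate S z0 t0 y : 0 <= S -> t0 <= 0 -> 0 < X z0 ->
  y = u z0 t0 / psi (radial_log P z0) ->
  y / (3 / 2 - y) * (E S / 2) <= E (radial_log P z0).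
Proof.
move=> S0 t00 Xz0 yE; pose sl : 'rV[R]_n -> R := radial_log P.
rewrite leNgt; apply/negP => bad.
pose G0 := E S / 2; have G00 : 0 < G0 by rewrite divr_gt0.
have Mx0 : 0 < Mx by apply: lt_le_trans (vM 0).
have M0 : 0 <= M by exact: ler0n.
pose K := Mx ^+ 4 * expR (2 * S) * (11 + 6 * M).
have K0 : 0 < K.
  by apply: mulr_gt0; [rewrite mulr_gt0 ?expR_gt0// exprn_gt0|lra].
pose eta := Num.sqrt (al ^+ 2 / 60 / K).
have eta0 : 0 < eta by rewrite sqrtr_gt0 !divr_gt0// exprn_gt0.
have hK : K * eta ^+ 2 <= al ^+ 2 / 60.
  rewrite sqr_sqrtr; first by rewrite mulrC divfK// gt_eqF.
  by rewrite ltW// !divr_gt0// exprn_gt0.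
pose L := G0 / eta; have L0 : 0 < L by rewrite divr_gt0.
have etaL : eta / L * L ^+ 2 = G0.
  by rewrite /L; field; rewrite !gt_eqF.
pose a0 := eta / L; have a00 : 0 < a0 by rewrite divr_gt0.
pose g0 := front P z0 a0 L t0.
pose zeta z t := u z t / psi (sl z).
pose q (x : R) := x / (3 / 2 - x).
pose H (x : 'rV[R]_n * R) := q (zeta x.1 x.2) * (Num.max (g0 x.1 x.2) 0 / E (sl x.1)).
have zeta1 z t : 0 < X z -> t <= 0 -> zeta z t <= 1.
  by move=> Xz t_le; rewrite ler_pdivrMr// mul1r ule.
have q2 x : x <= 1 -> q x <= 2.
  by move=> x1; rewrite ler_pdivrMr; lra.
have g0le z t : t <= t0 -> g0 z t <= G0.
  move=> tt; rewrite -etaL /g0 /front ler_pM2l//.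
  by have := sqdist_ge0 (others P) z0 z; lra.
have g00 : g0 z0 t0 = G0.
  have Y0 : sqdist (others P) z0 z0 = 0.
    by rewrite /sqdist big1// => i _; rewrite subrr expr0n.
  by rewrite /g0 /front Y0 subr0 subrr addr0 etaL.
have max0 z t : 0 <= Num.max (g0 z t) 0 by rewrite le_max lexx orbT.
have maxG z t : t <= t0 -> Num.max (g0 z t) 0 <= G0.
  by move=> tt; rewrite ge_max g0le//= ltW.
have ktt0 z t : 0 <= Num.max (g0 z t) 0 / E (sl z) by rewrite divr_ge0// ltW.
(* beyond radius exp(S) the growth of E beats g <= E(S) / 2 *)
have far z t : 0 < X z -> t <= t0 -> S <= sl z -> H (z, t) <= 1.
  move=> Xz tt Ss; have ES : E S <= E (sl z).
    by move: Ss; rewrite le_eqVlt => /orP[/eqP<-//|/growth_increasing/ltW].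
  have k1 : Num.max (g0 z t) 0 / E (sl z) <= 1 / 2.
    rewrite ler_pdivrMr//; apply: (le_trans (maxG z t tt)); rewrite /G0; lra.
  have := q2 _ (zeta1 z t Xz (le_trans tt t00)).
  rewrite /H /=; move: (ktt0 z t) k1; move: (_ / E _) (q _) => k Q; nra.
pose rho := expR (2 * S).
have shellK del := @compact_shell R n P z0 del rho (L ^+ 2).
have [C C0 hC] := compact_bound (t0 - L ^+ 2) (shellK 0).
(* del is the square radius below which the bound C on u makes H at most 1 *)
pose e := Num.min 1 (mn / (2 * C * G0)).
have e0 : 0 < e by rewrite lt_min ltr01 divr_gt0// !mulr_gt0.
have e1 : e <= 1 by rewrite ge_min lexx.
have eC : 2 * C * G0 * e <= mn.
  by rewrite mulrC -ler_pdivlMr ?mulr_gt0// ge_min lexx orbT.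
pose s1 := 2 / gam * ln e.
have s10 : s1 <= 0 by rewrite mulr_ge0_le0 ?divr_ge0 ?(ltW gam0)// ln_le0.
pose del := expR (2 * s1).
have Xsl z : 0 < X z -> X z = expR (2 * sl z).
  move=> Xz; have -> : 2 * sl z = ln (X z) by rewrite /sl /radial_log -/X; field.
  by rewrite lnK.
have near0 z t : 0 < X z -> X z < del -> t <= t0 -> H (z, t) <= 1.
  move=> Xz Xdel tt; have t_le := le_trans tt t00.
  have [g0t|g0t] := leP (g0 z t) 0.
    by rewrite /H /= (max_idPr g0t) mul0r mulr0 ler01.
  have ssl : sl z < s1 by move: Xdel; rewrite Xsl// ltr_expR ltr_pM2l.
  have sl0 : sl z <= 0 by rewrite ltW// (lt_le_trans ssl).
  have Xrho : X z <= rho.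
    by rewrite Xsl// ler_expR ler_pM2l// (le_trans sl0).
  have gpos : 0 < L ^+ 2 - sqdist (others P) z0 z + (t - t0).
    by move: g0t; rewrite /g0 /front pmulr_rgt0.
  have YL : sqdist (others P) z0 z <= L ^+ 2 by lra.
  have tL : t0 - L ^+ 2 <= t by have := sqdist_ge0 (others P) z0 z; lra.
  have uC : u z t <= C.
    by apply: hC; [rewrite /= (ltW Xz) Xrho YL|rewrite tL t_le].
  have [z0'|z0'] := leP (zeta z t) 0.
    apply: (le_trans _ ler01); rewrite /H /=; apply: mulr_le0_ge0 => //.
    by rewrite /q; apply: mulr_le0_ge0 => //; rewrite invr_ge0; lra.
  have zz1 := zeta1 z t Xz t_le.
  have q2z : q (zeta z t) <= 2 * zeta z t.
    have h0 := ltW z0'; rewrite /q ler_pdivrMr; last by lra.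
    by rewrite mulrAC ler_peMl//; lra.
  (* the bound on u makes zeta small like a power of the radius *)
  have zC : zeta z t <= C * expR (gam * sl z) / mn.
    rewrite /zeta /psi mulNr expRN ler_pdivlMr//.
    have -> : u z t / ((expR (gam * sl z))^-1 * v (sl z)) * mn =
      u z t * expR (gam * sl z) * (mn / v (sl z)).
      by field; rewrite (gt_eqF (v0 _)) (gt_eqF (expR_gt0 _)).
    have uz0 : 0 < u z t by move: z0'; rewrite /zeta pmulr_lgt0// invr_gt0.
    rewrite -[leRHS]mulr1; apply: ler_pM.
    - by rewrite mulr_ge0 ?expR_ge0 ?(ltW uz0).
    - by rewrite divr_ge0 ?(ltW mn0) ?(ltW (v0 _)).
    - by rewrite ler_wpM2r ?expR_ge0.
    - by rewrite ler_pdivrMr// mul1r.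
  have Elow := growth_lower al2 sl0.
  have sq : expR (gam * sl z) = expR (gam / 2 * sl z) ^+ 2.
    by rewrite -expRM_natl; congr expR; field.
  have se : expR (gam / 2 * sl z) <= e.
    rewrite -[leRHS]lnK// ler_expR; apply: ltW.
    have -> : ln e = gam / 2 * s1 by rewrite /s1; field; rewrite gt_eqF.
    by rewrite ltr_pM2l// divr_gt0.
  rewrite /H /= (max_idPl (ltW g0t)) mulrA ler_pdivrMr// mul1r.
  apply: (le_trans _ Elow); set f := expR (gam / 2 * sl z) in sq se *.
  have f0 : 0 < f by exact: expR_gt0.
  have h1 : q (zeta z t) * g0 z t <= 2 * (C * f ^+ 2 / mn) * G0.
    apply: ler_pM => //.
    - by rewrite /q divr_ge0 ?(ltW z0')//; lra.
    - exact: ltW.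
    - by apply: (le_trans q2z); rewrite ler_pM2l// -sq.
    - exact: g0le.
  apply: (le_trans h1).
  have -> : 2 * (C * f ^+ 2 / mn) * G0 = f * (2 * C * G0 * f / mn).
    by field; rewrite gt_eqF.
  rewrite -[leRHS]mulr1 ler_pM2l// ler_pdivrMr// mul1r; apply: (le_trans _ eC).
  by rewrite ler_pM2l// !mulr_gt0.
have Hbad : 1 < H (z0, t0).
  rewrite /H /= g00 (max_idPl (ltW G00)) mulrA ltr_pdivlMr// mul1r.
  by rewrite /q /zeta -yE.
pose D := [set z | del <= X z <= rho /\ sqdist (others P) z0 z <= L ^+ 2]
   `*` `[t0 - L ^+ 2, t0]%classic.
have inD z t : 0 < X z -> t <= t0 -> 0 < g0 z t -> 1 < H (z, t) -> D (z, t).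
  move=> Xz tt g0t H1.
  have gpos : 0 < L ^+ 2 - sqdist (others P) z0 z + (t - t0).
    by move: g0t; rewrite /g0 /front pmulr_rgt0.
  split => /=; last by rewrite in_itv /= tt andbT; have := sqdist_ge0 (others P) z0 z; lra.
  split; last by lra.
  apply/andP; split.
    by rewrite leNgt; apply/negP => h; have := near0 z t Xz h tt; rewrite leNgt H1.
  rewrite leNgt; apply/negP => h.
  have Ss : S <= sl z by move: h; rewrite Xsl// ltr_expR ltr_pM2l// => /ltW.
  by have := far z t Xz tt Ss; rewrite leNgt H1.
have DX x : D x -> 0 < X x.1 /\ x.2 <= t0.
  move=> [[/andP[h _] _]]; rewrite /= in_itv /= => /andP[_ ->]; split => //.
  by apply: lt_le_trans h; exact: expR_gt0.
have cD : compact D by apply: compact_setX; [exact: shellK|exact: segment_compact].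
have cH : {within D, continuous H}.
  have [cu _ _ _ _] := sol.
  have c1 : {within D, continuous (fun x : 'rV[R]_n * R => u x.1 x.2)}.
    apply: continuous_subspaceW cu => x /DX[_ /= h]; exact: le_trans h t00.
  have c2 : {within D, continuous (fun x : 'rV[R]_n * R => (psi (sl x.1))^-1)}.
    apply: continuous_in_subspaceT => x; rewrite inE => /DX[Xx _].
    apply: (@continuousV _ _ (fun x : 'rV[R]_n * R => psi (sl x.1)) x).
      by rewrite gt_eqF.
    exact: (@radial_continuous psi x psi_continuous Xx).
  have cz : {within D, continuous (fun x : 'rV[R]_n * R => zeta x.1 x.2)}.
    by move=> x; exact: (@continuousM _ _ _ _ x (c1 x) (c2 x)).
  have cq : {within D, continuous (fun x : 'rV[R]_n * R => q (zeta x.1 x.2))}.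
    rewrite continuous_subspace_in => x; rewrite inE => /DX[Xx tx].
    apply: (@continuousM _ _ (fun x : subspace D => zeta x.1 x.2)
      (fun x : subspace D => (3 / 2 - zeta x.1 x.2)^-1) x); first exact: cz.
    apply: (@continuousV _ _ (fun x : subspace D => 3 / 2 - zeta x.1 x.2) x); last first.
      by apply: continuousB; [exact: cst_continuous|exact: cz].
    by rewrite gt_eqF//; have := zeta1 x.1 x.2 Xx (le_trans tx t00); lra.
  have ck : {within D, continuous (fun x : 'rV[R]_n * R =>
      Num.max (g0 x.1 x.2) 0 / E (sl x.1))}.
    apply: continuous_in_subspaceT => x; rewrite inE => /DX[Xx _].
    apply: (@continuousM _ _ (fun x : 'rV[R]_n * R => Num.max (g0 x.1 x.2) 0)
      (fun x : 'rV[R]_n * R => (E (sl x.1))^-1) x).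
      apply: (@continuous_max R _ (fun x : 'rV[R]_n * R => g0 x.1 x.2) (fun=> 0)).
        exact: front_continuous.
      exact: cst_continuous.
    apply: (@continuousV _ _ (fun x : 'rV[R]_n * R => E (sl x.1)) x).
      by rewrite gt_eqF.
    exact: (@radial_continuous E x growth_continuous Xx).
  by move=> x; exact: (@continuousM _ _ _ _ x (cq x) (ck x)).
have D0 : D (z0, t0) by apply: inD => //; rewrite g00.
have [[zs ts]] := compact_EVT_max (ex_intro _ _ D0) cD cH.
rewrite inE => Ds Hmax.
pose Hs := H (zs, ts).
have Hs1 : 1 < Hs by apply: (lt_le_trans Hbad); apply: Hmax; rewrite inE.
have [/= Xs ts0] := DX _ Ds.
have ts00 := le_trans ts0 t00.
have g0s : 0 < g0 zs ts.
  rewrite ltNge; apply/negP => h; move: Hs1.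
  by rewrite /Hs /H /= (max_idPr h) mul0r mulr0 ltr10.
have Hs0 : 0 < Hs by rewrite (lt_trans ltr01).
(* lowering the front by the factor Hs turns the maximum into a contact *)
pose a := a0 / Hs; have apos : 0 < a by rewrite divr_gt0.
have gE z t : front P z0 a L t0 z t = g0 z t / Hs.
  by rewrite /g0 /front /a; ring.
have HE z t : 0 < g0 z t -> H (z, t) = Hs * (q (zeta z t) * (front P z0 a L t0 z t / E (sl z))).
  move=> h; rewrite gE /H /= (max_idPl (ltW h)).
  by field; rewrite (gt_eqF Hs0) (gt_eqF (E0 _)).
have zs1 := zeta1 zs ts Xs ts00.
have gs : 0 < front P z0 a L t0 zs ts by rewrite gE divr_gt0.
have qs : q (zeta zs ts) * (front P z0 a L t0 zs ts / E (sl zs)) = 1.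
  have := HE zs ts g0s; rewrite -/Hs => h.
  by apply: (mulfI (lt0r_neq0 Hs0)); rewrite mulr1 -h.
have zE := logistic_eq zs1 (E0 _) gs qs.
have Eg : E (sl zs) <= 2 * front P z0 a L t0 zs ts.
  have d0 : 0 < E (sl zs) + front P z0 a L t0 zs ts by rewrite addr_gt0.
  by move: zs1; rewrite zE ler_pdivrMr//; lra.
have slS : sl zs <= S.
  rewrite leNgt; apply/negP => /growth_increasing h.
  have : front P z0 a L t0 zs ts <= G0.
    rewrite gE ler_pdivrMr//; apply: (le_trans (g0le zs ts ts0)).
    by rewrite ler_peMr// ltW.
  by rewrite /G0; lra.
apply: (@no_contact z0 L t0 S eta a ts zs) => //.
- by rewrite /a /a0; have -> : eta / L / Hs * L = eta / Hs;
    [field; rewrite !gt_eqF|rewrite ler_pdivrMr// ler_peMr// ltW].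
- exact: growth_dominates.
- have -> : u zs ts = psi (sl zs) * zeta zs ts by rewrite /zeta mulrC divfK// gt_eqF.
  by rewrite zE /psi -mulrA.
move=> z t tts Xz gz.
have tt := le_trans tts ts0.
have g0z : 0 < g0 z t by move: gz; rewrite gE pmulr_lgt0// invr_gt0.
have zz1 := zeta1 z t Xz (le_trans tt t00).
have HHs : H (z, t) <= Hs.
  have [h|h] := leP (H (z, t)) 1; first exact: (le_trans h (ltW Hs1)).
  by apply: Hmax; rewrite inE; exact: inD.
have := HHs; rewrite HE// -[leRHS]mulr1 ler_pM2l// logistic_le//.
by rewrite /zeta ler_pdivrMr// /barrier => /le_trans; apply; rewrite mulrC /psi mulrA.
Qed.

(** Letting S tend to infinity in [upper_estimate] is replaced by the explicit
  value of S for which the linear lower bound on E S gives a contradiction. *)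
Lemma nonpositive_off_axis z0 t0 : t0 <= 0 -> 0 < X z0 -> u z0 t0 <= 0.
Proof.
move=> t00 Xz0; rewrite leNgt; apply/negP => u0.
pose s0 := radial_log P z0.
pose y := u z0 t0 / psi s0.
have y0 : 0 < y by rewrite divr_gt0.
have y1 : y <= 1 by rewrite ler_pdivrMr// mul1r ule.
pose k := y / (3 / 2 - y).
have k0 : 0 < k by rewrite divr_gt0//; lra.
have Mx0 : 0 < Mx by apply: lt_le_trans (vM 0).
pose c := al / Mx ^+ 2.
have c0 : 0 < c by rewrite divr_gt0// exprn_gt0.
pose S := 2 * E s0 / (k * c).
have S0 : 0 < S by apply: divr_gt0; apply: mulr_gt0.
have h := @upper_estimate S z0 t0 y (ltW S0) t00 Xz0 erefl.
have : k * ((1 + c * S) / 2) <= E s0.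
  apply: le_trans h; rewrite ler_pM2l// ler_pM2r//; exact: growth_unbounded.
have -> : k * ((1 + c * S) / 2) = k / 2 + E s0.
  by rewrite /S; field; rewrite (gt_eqF c0) (gt_eqF k0).
by rewrite gerDr leNgt divr_gt0.
Qed.

End FrontComparison.

(** * Liouville theorem for split variables *)

Section Liouville.
Variable R : realType.

Lemma pS_sub1_gt0 N : (2 < N)%N -> 0 < pS R N - 1.
Proof.
move=> N2; have h : 0 < N%:R - 2 :> R by rewrite subr_gt0 ltr_nat.
rewrite subr_gt0 /pS ltr_pdivlMr// mul1r; lra.
Qed.

(** The constants of the comparison are chosen here; the points with x = 0,
  where psi gives no bound, are recovered by continuity. *)
Lemma liouville_nonpos (n N : nat) (P : pred 'I_n) (v : R -> R)
    (u ut : 'rV[R]_n -> R -> R) :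
  (2 < N)%N -> #|P| = N -> delaunay_profile N v ->
  past_solution (pS R N) u ut ->
  (forall z t, 0 < sqdist P 0 z -> t <= 0 -> u z t <=
     expR (- ((N%:R - 2) / 2) * radial_log P z) * v (radial_log P z)) ->
  forall z t, t <= 0 -> u z t <= 0.
Proof.
move=> N2 cP [v0 [T T0 vT] dv dv1 ode] sol ule.
set gam := (N%:R - 2) / 2 in ule; set p := pS R N in sol ode *.
have gam0 : 0 < gam by rewrite /gam divr_gt0// subr_gt0 ltr_nat.
have p10 : 0 < p - 1 by exact: pS_sub1_gt0.
have dv' (s : R) : is_derive s 1 v (derive1 v s).
  by apply: DeriveDef; [exact: dv|rewrite derive1E].
have dv1' (s : R) : is_derive s 1 (derive1 v) (derive1n 2 v s).
  by apply: DeriveDef; [exact: dv1|rewrite derive1nS derive1n1 derive1E].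
have cv : continuous v by move=> s; exact: is_derive_continuous (dv' s).
have [mn [Mx [mn0 vb]]] := periodic_positive_bounds T0 cv vT v0.
have vm s : mn <= v s by case/andP: (vb s).
have vM s : v s <= Mx by case/andP: (vb s).
have ci : continuous (fun s => (v s ^+ 2)^-1).
  move=> s; apply: (@continuousV _ _ (fun s => v s ^+ 2)).
    by rewrite expf_neq0// gt_eqF.
  by apply: (@continuous_comp _ _ _ v (fun y => y ^+ 2)); [exact: cv|exact: exprn_continuous].
have [r r0 dr] := primitive_exists ci.
pose m := mn `^ (p - 1) * mn ^+ 4.
have m0 : 0 < m by rewrite mulr_gt0 ?powR_gt0 ?exprn_gt0.
have hm s : m <= v s `^ (p - 1) * v s ^+ 4.
  apply: ler_pM; rewrite ?powR_ge0 ?exprn_ge0 ?(ltW mn0)//.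
    by rewrite ge0_ler_powR ?nnegrE ?(ltW mn0) ?(ltW (v0 s)) ?(ltW p10).
  by rewrite lerXn2r ?nnegrE ?(ltW mn0) ?(ltW (v0 s)).
pose k := m * (1 - (9 / 10) `^ (p - 1)).
have k0 : 0 < k.
  have : (9 / 10) `^ (p - 1) < (1 : R) `^ (p - 1).
    by rewrite gt0_ltr_powR ?nnegrE//; lra.
  by rewrite powR1 => ?; rewrite mulr_gt0// subr_gt0.
pose al := Num.min (Num.min 1 (k / 2)) (Num.min (mn ^+ 2) (gam / 2 * mn ^+ 2)).
have al0 : 0 < al.
  have h1 : 0 < mn ^+ 2 by rewrite exprn_gt0.
  by rewrite !lt_min ltr01 h1 (divr_gt0 k0)//= mulr_gt0// divr_gt0.
have [al1 al2 al3 al4] : [/\ al <= 1, al <= k / 2, al <= mn ^+ 2 & al <= gam / 2 * mn ^+ 2].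
  by rewrite /al; split; rewrite !ge_min lexx ?orbT.
have hal : 2 * al ^+ 2 <= k.
  have : al * al <= k / 2 * 1 by apply: ler_pM => //; exact: ltW.
  by rewrite expr2; lra.
have off z t : t <= 0 -> 0 < sqdist P 0 z -> u z t <= 0.
  move=> t0 Xz; have ode' s : derive1n 2 v s = gam ^+ 2 * v s - v s `^ p.
    by have := ode s; rewrite /gam; lra.
  exact: (@nonpositive_off_axis R n N P gam al m Mx mn v (derive1 v) (derive1n 2 v) r u ut).
move=> z t t0; have := sqdist_ge0 P 0 z; rewrite le_eqVlt => /orP[/eqP X0|]; last exact: off.
(* a line in a direction of P meets the set x = 0 in at most one point *)
rewrite leNgt; apply/negP => uz0.
have [i Pi] : exists i, P i.
  by apply/existsP; rewrite -[[exists _, _]]negbK negb_exists; apply/negP => /forallP h;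
    move: N2; rewrite -cP eq_card0 // => i; apply/negbTE; exact: h.
have [_ du _ _ _] := sol.
have dl := is_derive_line (du i (z + 0 *: basis_vec R i) t t0).
have cl : u (z + h *: basis_vec R i) t @[h --> (0 : R)] --> u (z + 0 *: basis_vec R i) t.
  exact: (is_derive_continuous dl).
rewrite scale0r addr0 in cl.
have pos := cvgr_gt _ cl _ uz0.
have [h [h0 uh]] : exists h : R, h != 0 /\ 0 < u (z + h *: basis_vec R i) t.
  have /nbhs_ballP[e /= e0 he] : nbhs (0 : R) (fun h => 0 < u (z + h *: basis_vec R i) t).
    exact: pos.
  exists (e / 2); split; first by rewrite gt_eqF// divr_gt0.
  by apply: he; rewrite /ball /= sub0r normrN gtr0_norm; lra.
have zi : z ord0 i = 0.
  move: X0; rewrite /sqdist (bigD1 i)//= mxE subr0 => /esym/eqP.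
  rewrite paddr_eq0 ?sqr_ge0//; last by apply: sumr_ge0 => j _; exact: sqr_ge0.
  by rewrite sqrf_eq0 => /andP[/eqP].
have : u (z + h *: basis_vec R i) t <= 0.
  apply: off => //; rewrite sqdist_line// -X0 zi mxE subrr mulr0 mul0r !add0r.
  by rewrite lt_def sqrf_eq0 h0 sqr_ge0.
by rewrite leNgt uh.
Qed.

Lemma partialN n (i : 'I_n) (f : 'rV[R]_n -> R) x :
  has_partial i f x -> partial i (fun z => - f z) x = - partial i f x.
Proof. by move=> df; exact: (deriveN df). Qed.

Lemma past_solutionN n p (u ut : 'rV[R]_n -> R -> R) : past_solution p u ut ->
  past_solution p (fun z t => - u z t) (fun z t => - ut z t).
Proof.
case=> cu du ddu dut eq.
have pN i t : t <= 0 -> partial i (fun z => - u z t) = (fun z => - partial i (u^~ t) z).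
  by move=> t0; apply/funext => z; rewrite partialN//; exact: du.
split.
- by move=> x; apply: continuousN; exact: cu.
- by move=> i x t t0; apply: derivableN; exact: du.
- by move=> i x t t0; rewrite pN//; apply: derivableN; exact: ddu.
- move=> x t t0; have := dut x t t0 => /cvgN; apply: cvg_trans.
  have -> : time_quotient (fun z t => - u z t) x t = (fun s => - time_quotient u x t s).
    by apply/funext => s; rewrite /time_quotient -mulNr opprB opprK addrC.
  exact: cvg_refl.
- move=> x t t0; rewrite eq// /power_nonlin normrN mulrN opprD; congr (_ - _).
  rewrite /laplacian -sumrN; apply: eq_bigr => i _.
  by rewrite pN// partialN//; exact: ddu.
Qed.

Lemma heat_past_solution n p (u : 'rV[R]_n -> R -> R) : heat_solution p u ->
  past_solution p u (time_deriv u).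
Proof.
case=> -[cu dt _ dx dxx] eq; split.
- exact: cu.
- by move=> i x t; have [h _] := dx i; exact: h.
- by move=> i x t; have [h _] := dxx i i; exact: h.
- exact: dt.
- exact: eq.
Qed.

Lemma elliptic_past_solution n p (u : 'rV[R]_n -> R) : elliptic_solution p u ->
  past_solution p (fun z _ => u z) (fun _ _ => 0).
Proof.
case=> -[cu du _ ddu _] eq; split.
- apply: continuous_subspaceT => x.
  by apply: (@continuous_comp _ _ _ fst u); [exact: cvg_fst|exact: cu].
- by move=> i x _ _; exact: du.
- by move=> i x _ _; exact: ddu.
- move=> x t _; have -> : time_quotient (fun z _ => u z) x t = (fun=> 0).
    by apply/funext => s; rewrite /time_quotient subrr mul0r.
  exact: cvg_cst.
- by move=> x t _; rewrite eq.
Qed.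

Lemma liouville (n N : nat) (P : pred 'I_n) (v : R -> R)
    (u ut : 'rV[R]_n -> R -> R) :
  (2 < N)%N -> #|P| = N -> delaunay_profile N v ->
  past_solution (pS R N) u ut ->
  (forall z t, 0 < sqdist P 0 z -> t <= 0 -> `|u z t| <=
     expR (- ((N%:R - 2) / 2) * radial_log P z) * v (radial_log P z)) ->
  forall z t, t <= 0 -> u z t = 0.
Proof.
move=> N2 cP hv sol ule z t t0; apply/eqP; rewrite eq_le; apply/andP; split.
  apply: (liouville_nonpos N2 cP hv sol) => // z' t' Xz t0'.
  exact: le_trans (ler_norm _) (ule z' t' Xz t0').
rewrite -oppr_le0.
apply: (liouville_nonpos N2 cP hv (past_solutionN sol) _ z t0) => z' t' Xz t0'.
by apply: le_trans (ule z' t' Xz t0'); rewrite -normrN ler_norm.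
Qed.

Lemma delaunay_solutionE N (v : R -> R) (psi : 'rV[R]_N -> R) (x : 'rV[R]_N) (X : R) :
  (forall x, x != 0 ->
     psi x = enorm x `^ (- ((N%:R - 2) / 2)) * v (ln (enorm x))) ->
  0 < X -> \sum_(i < N) x ord0 i ^+ 2 = X ->
  x != 0 /\ psi x = expR (- ((N%:R - 2) / 2) * (ln X / 2)) * v (ln X / 2).
Proof.
move=> hpsi X0 xX.
have x0 : x != 0.
  apply/eqP => x0; move: X0; rewrite -xX big1 ?ltxx// => i _.
  by rewrite x0 mxE expr0n.
split=> //; rewrite hpsi// /enorm xX.
have -> : ln (Num.sqrt X) = ln X / 2.
  by rewrite -powR12_sqrt ?ltW// ln_powR mulrC.
by rewrite -powR12_sqrt ?ltW// -powRrM /powR gt_eqF//; congr (expR _ * _); ring.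
Qed.

End Liouville.

Unset Implicit Arguments.

Theorem theorem3 (R : realType) (N : nat) (hN : (3 <= N)%N)
    (psi : 'rV[R]_N -> R) (hpsi : delaunay_solution psi) :
  (forall u : 'rV[R]_N -> R -> R,
     heat_solution (pS R N) u ->
     (forall x t, x != 0 -> t <= 0 -> `|u x t| <= psi x) ->
     forall x t, t <= 0 -> u x t = 0)
  /\
  (forall (M : nat) (u : 'rV[R]_(N + M) -> R),
     elliptic_solution (pS R N) u ->
     (forall (x : 'rV[R]_N) (y : 'rV[R]_M), x != 0 ->
        `|u (row_mx x y)| <= psi x) ->
     forall z, u z = 0).
Proof.
case: hpsi => v hv psiE; split=> [u hu ule|M u hu ule].
  have cP : #|(predT : pred 'I_N)| = N by rewrite card_ord.
  apply: (liouville hN cP hv (heat_past_solution hu)) => x t X0 t0.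
  have [|x0 <-] := delaunay_solutionE (x := x) psiE X0; last exact: ule.
  by apply: eq_bigr => i _; rewrite mxE subr0.
pose P : pred 'I_(N + M) := fun i => (i < N)%N.
have Pl i : P (lshift M i) = true by exact: (ltn_ord i).
have Pr i : P (rshift N i) = false by apply/negbTE; rewrite /P -leqNgt leq_addr.
have cP : #|P| = N.
  rewrite -sum1_card big_mkcond big_split_ord /=.
  rewrite [X in (_ + X)%N]big1 ?addn0; last first.
    by move=> i _; rewrite ifF//; exact: Pr.
  rewrite (eq_bigr (fun=> 1%N)) ?sum1_card ?card_ord// => i _.
  by rewrite ifT//; exact: Pl.
move=> z; apply: (liouville hN cP hv (elliptic_past_solution hu) _ z (lexx 0)) => {}z t X0 _.
have [|x0 <-] := delaunay_solutionE (x := lsubmx z) psiE X0.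
  rewrite /sqdist big_split_ord /= [X in _ + X]big_pred0 ?addr0; last exact: Pr.
  by apply: eq_big => i; rewrite ?Pl// !mxE subr0.
by rewrite -[z in u z]hsubmxK; exact: ule.
Qed.
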